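(* Let $\mathcal{A}$ be a finite alphabet, $\mathcal{F}\subset\mathcal{A}^*$ a set of forbidden words, and $X=X(\mathcal{A},\mathcal{F})$ the induced subshift. If there exists $\beta < 2h(X) - \log |\mathcal{A}|$ for which \[ \sum_{n = 1}^{\infty} n|\mathcal{F}_n| e^{-n \beta} < \frac{1}{36}, \] then $|\mathcal{L}_n(X)| < 4 e^{nh(X)}$ for all sufficiently large $n$.
   Context: $\mathcal{A}^*$ is the set of finite (nonempty) words over $\mathcal{A}$, and $\mathcal{F}_n$ is the set of words in $\mathcal{F}$ of length $n$ ($\mathcal{F}$ may be infinite). $X(\mathcal{A},\mathcal{F})$ is the set of all $x\in\mathcal{A}^{\mathbb{Z}}$ that contain no word from $\mathcal{F}$ as a (contiguous) subword; it is assumed nonempty. $\mathcal{L}_n(X)$ is the set of words of length $n$ appearing in points of $X$. The topological entropy is $h(X)=\lim_{n\to\infty}\frac1n\log|\mathcal{L}_n(X)|$ (natural logarithm throughout). *)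

(* Defs.v *)
From HB Require Import structures.
From mathcomp Require Import all_boot all_order all_algebra.
From mathcomp Require Import all_classical all_reals all_analysis.

Set Implicit Arguments.
Unset Strict Implicit.
Unset Printing Implicit Defensive.

Import Order.TTheory GRing.Theory Num.Theory.
Import numFieldNormedType.Exports.

Local Open Scope classical_set_scope.
Local Open Scope ring_scope.

(* Points of A^Z are functions int -> A. *)

Section Subshift.
Variable A : finType.

Definition appears (w : seq A) (x : int -> A) : Prop :=
  exists i : int, w = mkseq (fun k : nat => x (i + k%:Z)) (size w).

Definition subshift (F : set (seq A)) : set (int -> A) :=
  [set x | forall w, F w -> ~ appears w x].

Definition words_of_length (F : set (seq A)) (n : nat) : {set n.-tuple A} :=
  [set w : n.-tuple A | `[< F w >]]%SET.

Definition language (X : set (int -> A)) : set (seq A) :=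
  [set w | exists2 x, X x & appears w x].

(* Natural logarithm. The term n = 0 is 0 (division by 0) and does not affect
   the limit, which exists in R for a nonempty shift-invariant X. *)
Definition entropy (R : realType) (X : set (int -> A)) : R :=
  limn (fun n : nat => ln (#|words_of_length (language X) n|%:R : R) / n%:R).

End Subshift.

Arguments entropy {A} R X.

(* Main.v *)
Require Import Defs.
From HB Require Import structures.
From mathcomp Require Import all_boot all_order all_algebra.
From mathcomp Require Import all_classical all_reals all_analysis.
From mathcomp Require Import zify ring lra.

Set Implicit Arguments.
Unset Strict Implicit.
Unset Printing Implicit Defensive.

Import Order.TTheory GRing.Theory Num.Theory.
Import numFieldNormedType.Exports.

Local Open Scope classical_set_scope.
Local Open Scope ring_scope.

(** Write a n for the number of words of length n that avoid F, h for the entropy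
of X, and r n for a n e^(-nh). Words of X avoid F, so it suffices to bound a n,
and the argument gives r n <= 36/35 for every n.

The count a is easier to handle than the count of words of X: a concatenation
of two F-avoiding words fails to avoid F only because of a forbidden word that
straddles the junction, and cutting that word out leaves two shorter F-avoiding
words ([nwords_avoids_mul]). Call m a record if r j <= r m for all j <= m. At a
record, a (m - j) <= a m e^(-jh), so among the (a m)^2 concatenations the
forbidden words of length k spoil at most k |F_k| e^(-kh) (a m)^2. Since the
entropy is at most log |A|, the condition on beta forces beta < h, and the
hypothesis on the series bounds the spoiled proportion by 1/36. Hence
r (2m) >= (35/36) (r m)^2 at every record m ([nwords_avoids_record]).

If (35/36) r n > 1 for some n, repeatedly passing to a record and doubling makes
r grow exponentially along a sequence of indices ([record_growth]). This is
impossible because a has the same exponential growth rate as the word count of X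
([nwords_avoids_growth]): by compactness, F-avoiding words that extend
far enough to both sides are words of X ([language_extendable],
[antitone_stable]), and removing the two ends of an F-avoiding word costs only
a constant factor. Finally, the limit defining the entropy exists and is an
infimum, by Fekete's lemma ([submultiplicative_cvg]). *)

(** * Counting words *)

Section Words.
Local Open Scope nat_scope.
Variable A : finType.
Implicit Types (W V F : set (seq A)) (u v w p q : seq A).

(** Enumerating plain sequences instead of tuples lets words be cut and
concatenated without casting lengths. *)
Definition words W n : seq (seq A) :=
  [seq val t | t <- enum (words_of_length W n)].

Definition nwords W n := #|words_of_length W n|.

Lemma size_words W n : size (words W n) = nwords W n.
Proof. by rewrite size_map -cardE. Qed.

Lemma uniq_words W n : uniq (words W n).
Proof. by rewrite map_inj_uniq ?enum_uniq //; exact: val_inj. Qed.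

Lemma wordsP W n w : reflect (W w /\ size w = n) (w \in words W n).
Proof.
apply: (iffP mapP) => [[t]|[Ww sw]].
  by rewrite mem_enum inE => /asboolP Wt ->; rewrite size_tuple.
have sw' : size w == n by apply/eqP.
by exists (Tuple sw') => //; rewrite mem_enum inE; apply/asboolP.
Qed.

Lemma nwords_le W V n : (forall w, size w = n -> W w -> V w) ->
  nwords W n <= nwords V n.
Proof.
move=> WV; rewrite -!size_words; apply: uniq_leq_size (uniq_words _ _) _.
by move=> w /wordsP[Ww sw]; apply/wordsP; split=> //; exact: WV.
Qed.

Lemma nwords_le_expn W n : nwords W n <= #|A| ^ n.
Proof. by rewrite -card_tuple; exact: max_card. Qed.

Definition factorial_language W := forall w u, infix u w -> W w -> W u.

Lemma factorial_take W w n : factorial_language W -> W w -> W (take n w).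
Proof. by move=> fW; apply: fW; exact: infix_take. Qed.

Lemma factorial_drop W w n : factorial_language W -> W w -> W (drop n w).
Proof. by move=> fW; apply: fW; exact: infix_drop. Qed.

Lemma nwordsD W m n : factorial_language W ->
  nwords W (m + n) <= nwords W m * nwords W n.
Proof.
move=> fW; rewrite -!size_words -(size_allpairs (fun x y => x ++ y)).
apply: uniq_leq_size (uniq_words _ _) _ => w /wordsP[Ww sw].
rewrite -(cat_take_drop m w); apply: allpairs_f; apply/wordsP; split.
- exact: factorial_take.
- by rewrite size_takel // sw leq_addr.
- exact: factorial_drop.
- by rewrite size_drop sw addKn.
Qed.

Definition avoids F : set (seq A) := [set w | forall u, F u -> ~~ infix u w].

Lemma factorial_avoids F : factorial_language (avoids F).
Proof.
by move=> w u uw Fw v Fv; apply: contra (Fw v Fv) => vu; exact: infix_trans uw.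
Qed.

(** If w ++ v contains a forbidden u, then u overlaps both w and v, since each of
them avoids F; here i is the length of the part of u lying in w. *)
Lemma cat_avoids F n m w v : size w = n -> size v = m ->
  avoids F w -> avoids F v ->
  avoids F (w ++ v) \/
  exists k u i p q, [/\ [/\ 0 < k < (n + m).+1, size u = k & F u],
     [/\ i < k, i <= n & k - i <= m],
     avoids F p /\ size p = n - i,
     avoids F q /\ size q = m - (k - i) & w ++ v = p ++ u ++ q].
Proof.
move=> sw sv Fw Fv; have [|/existsNP[u]] := pselect (avoids F (w ++ v)).
  by left.
move=> /not_implyP[Fu /negP]; rewrite negbK => /infixP[p [q e]]; right.
have sz : n + m = size p + (size u + size q).
  by rewrite -sw -sv -!size_cat e.
have pn : size p < n.
  rewrite ltnNge; apply/negP => np; have /negP := Fv u Fu; apply.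
  apply/infixP; exists (drop n p), q.
  have := congr1 (drop n) e; rewrite (drop_size_cat v sw) => ->.
  rewrite drop_cat; case: ltngtP np => // -> _.
  by rewrite subnn drop0 drop_size.
have nu : n < size p + size u.
  rewrite ltnNge; apply/negP => np; have /negP := Fw u Fu; apply.
  have := congr1 (take n) e; rewrite (take_size_cat v sw) => ->.
  rewrite catA take_cat size_cat ltnNge np /= -catA.
  by apply: infix_infix.
exists (size u), u, (n - size p), p, q; split=> //.
- by split=> //; lia.
- by split; lia.
- split; last by rewrite subKn // ltnW.
  have -> : p = take (size p) w.
    have := congr1 (take (size p)) e.
    by rewrite take_size_cat // take_cat sw pn => ->.
  by apply: factorial_take Fw; exact: factorial_avoids.
- split; last by move: (size p) (size u) (size q) sz pn nu; clear; lia.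
  have -> : q = drop (size p + size u - n) v.
    have := congr1 (drop (size p + size u)) e.
    rewrite catA [in RHS]drop_size_cat ?size_cat // => <-.
    by rewrite drop_cat sw ltnNge ltnW.
  by apply: factorial_drop Fv; exact: factorial_avoids.
Qed.

Lemma size_flatten_map (T S : Type) (s : seq S) (f : S -> seq T) :
  size (flatten [seq f x | x <- s]) = \sum_(x <- s) size (f x).
Proof. by rewrite size_flatten sumnE !big_map. Qed.

(** The pairs whose concatenation does not avoid F are counted through the
decomposition p ++ u ++ q of [cat_avoids]: the forbidden word u, the
position i of the junction in u, and the avoiding words p and q determine
the concatenation. *)
Lemma nwords_avoids_mul F n m (a := nwords (avoids F)) :
  a n * a m <= a (n + m) + \sum_(1 <= k < (n + m).+1)
    \sum_(0 <= i < k | (i <= n) && (k - i <= m))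
       nwords F k * (a (n - i) * a (m - (k - i))).
Proof.
pose bad k i := [seq pq.1 ++ u ++ pq.2 | u <- words F k,
  pq <- [seq (p, q) | p <- words (avoids F) (n - i),
                      q <- words (avoids F) (m - (k - i))]].
rewrite /a -!size_words -(size_allpairs (fun x y => x ++ y)).
pose bads := flatten [seq flatten [seq bad k i |
  i <- index_iota 0 k & (i <= n) && (k - i <= m)] | k <- index_iota 1 (n + m).+1].
have -> : \sum_(1 <= k < (n + m).+1) \sum_(0 <= i < k | (i <= n) && (k - i <= m))
    nwords F k * (nwords (avoids F) (n - i) * nwords (avoids F) (m - (k - i)))
    = size bads.
  rewrite /bads size_flatten_map; apply: eq_bigr => k _.
  rewrite size_flatten_map big_filter; apply: eq_bigr => i _.
  by rewrite /bad !size_allpairs !size_words.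
rewrite -size_cat; apply: uniq_leq_size => [|x /allpairsP[[w v]]].
  apply: allpairs_uniq; rewrite ?uniq_words // => -[w v] [w' v'].
  move=> /allpairsP[[? ?] [/wordsP[_ sw] _ [-> _]]].
  move=> /allpairsP[[? ?] [/wordsP[_ sw'] _ [-> _]]] /= /eqP.
  by rewrite eqseq_cat ?sw ?sw' // => /andP[/eqP -> /eqP ->].
move=> [/wordsP[/= Fw sw] /wordsP[/= Fv sv] ->]; rewrite mem_cat.
have [Fwv|] := cat_avoids sw sv Fw Fv.
  by apply/orP; left; apply/wordsP; rewrite size_cat sw sv.
move=> [k [u [i [p [q [[kb su Fu] [ik iN kim] [Fp sp] [Fq sq] ->]]]]]].
apply/orP; right; apply/flatten_mapP; exists k; first by rewrite mem_index_iota.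
apply/flatten_mapP; exists i; first by rewrite mem_filter mem_index_iota iN kim.
apply/allpairsP; exists (u, (p, q)); split=> //; first exact/wordsP.
by apply/allpairsP; exists (p, q); split=> //; apply/wordsP.
Qed.

(** * Compactness *)

(** Each t for which P t fails somewhere comes with an index of failure; N bounds
these finitely many indices, and a failure persists at larger indices. *)
Lemma antitone_stable (T : finType) (P : T -> nat -> Prop) :
  (forall t m n, m <= n -> P t n -> P t m) ->
  exists N, forall t, P t N -> forall n, P t n.
Proof.
move=> mono.
have /choice[f fP] t : exists N, P t N -> forall n, P t n.
  have [Pt|/existsNP[N nP]] := pselect (forall n, P t n); first by exists 0.
  by exists N.
exists (\max_t f t) => t Pt; apply: fP; apply: mono Pt.
exact: leq_bigmax.
Qed.

Definition extendable F N : set (seq A) :=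
  [set w | exists p q, [/\ size p = N, size q = N & avoids F (p ++ w ++ q)]].

(** Trim the two extensions. *)
Lemma extendable_antitone F w m n :
  m <= n -> extendable F n w -> extendable F m w.
Proof.
move=> mn [p [q [sp sq Fpwq]]]; exists (drop (n - m) p), (take m q); split.
- by rewrite size_drop sp subKn.
- by rewrite size_takel // sq.
- apply: (factorial_avoids _ Fpwq).
  apply/infixP; exists (take (n - m) p), (drop m q).
  by rewrite -!catA (catA (take _ p)) !cat_take_drop.
Qed.

Lemma factorial_extendable F N : factorial_language (extendable F N).
Proof.
move=> w u /infixP[s [t ->]] [p [q [sp sq]]] Fw.
exists (drop (size s) (p ++ s)), (take N (t ++ q)); split.
- by rewrite size_drop size_cat sp addnK.
- by rewrite size_takel // size_cat sq leq_addl.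
- apply: (factorial_avoids _ Fw).
  apply/infixP; exists (take (size s) (p ++ s)), (drop N (t ++ q)).
  by rewrite -!catA cat_take_drop [in RHS]catA [RHS]catA cat_take_drop -!catA.
Qed.

(** Split an avoiding word into its two ends of length N and its middle part,
which these ends extend. *)
Lemma nwords_avoids_extendable F N n :
  nwords (avoids F) (N + n + N) <= #|A| ^ N * nwords (extendable F N) n * #|A| ^ N.
Proof.
apply: (@leq_trans (nwords setT N * nwords (extendable F N) n * nwords setT N)).
  rewrite -!size_words -(size_allpairs (fun x y => x ++ y)).
  rewrite -(size_allpairs (fun x y => x ++ y)).
  apply: uniq_leq_size (uniq_words _ _) _ => w /wordsP[Fw sw].
  have -> : w = (take N w ++ take n (drop N w)) ++ drop n (drop N w).
    by rewrite -catA !cat_take_drop.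
  have sp : size (take N w) = N by rewrite size_takel // sw -addnA leq_addr.
  have sd : size (drop N w) = n + N by rewrite size_drop sw -addnA addKn.
  have sm : size (take n (drop N w)) = n by rewrite size_takel // sd leq_addr.
  have sq : size (drop n (drop N w)) = N by rewrite size_drop sd addKn.
  apply: allpairs_f; last exact/wordsP.
  apply: allpairs_f; first exact/wordsP.
  apply/wordsP; split=> //; exists (take N w), (drop n (drop N w)).
  by split=> //; rewrite !cat_take_drop.
by rewrite !leq_mul // nwords_le_expn.
Qed.

(** The pigeonhole step of Koenig's lemma: among the finitely many pairs of
neighbouring letters, one occurs in extensions of arbitrary length. *)
Lemma extendable_step F w : (forall N, extendable F N w) ->
  exists ab : A * A, forall N, extendable F N (ab.1 :: rcons w ab.2).
Proof.
move=> extw.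
have [|N NP] := @antitone_stable _
    (fun (ab : A * A) N => extendable F N (ab.1 :: rcons w ab.2)).
  by move=> ab m n; exact: extendable_antitone.
have [p [q [sp sq Fpwq]]] := extw N.+1.
case/lastP: p sp Fpwq => // p a; rewrite size_rcons => -[sp].
case: q sq => // b q [sq] Fpwq; exists (a, b); apply: NP.
by exists p, q; split=> //=; rewrite cat_rcons -cats1 -catA in Fpwq *.
Qed.

(** Iterating [extendable_step] gives words W k, each obtained from the previous
one by adding a letter at both ends; their union is a bi-infinite point,
and any forbidden word in it would already occur in some W k. *)
Lemma language_extendable F w :
  (forall N, extendable F N w) -> language (subshift F) w.
Proof.
move=> extw.
have /choice[g gP] v : exists ab : A * A, (forall N, extendable F N v) ->
    forall N, extendable F N (ab.1 :: rcons v ab.2).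
  have [extv|nextv] := pselect (forall N, extendable F N v).
    by have [ab] := extendable_step extv; exists ab.
  have [ab _] := extendable_step extw; exists ab => extv; by case: nextv.
pose W := fix W k := if k is k'.+1 then (g (W k')).1 :: rcons (W k') (g (W k')).2
  else w.
have extW k : forall N, extendable F N (W k) by elim: k => //= k; exact: gP.
have sW k : size (W k) = size w + k.*2.
  elim: k => [|k IH] /=; first by rewrite addn0.
  by rewrite size_rcons IH doubleS !addnS.
pose d := (g w).1.
have WD k j (p : nat) : p < size (W k) -> nth d (W (k + j)) (p + j) = nth d (W k) p.
  move=> pk; elim: j => [|j IH]; first by rewrite !addn0.
  rewrite !addnS /= nth_rcons -IH ifT // sW doubleD.
  by move: pk; rewrite sW; move: (size w); clear; lia.
(* Position p of W k carries coordinate p - k. The index |i| + 1, rather than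
   |i|, makes the window contain coordinate i even when w is empty. *)
pose x (i : int) := nth d (W `|i|.+1) `|(i + (`|i|.+1)%:Z)%R|.
have xE k (p : nat) : p < size (W k) -> x (p%:Z - k%:Z)%R = nth d (W k) p.
  move=> pk; rewrite /x; set K := `|_|.+1.
  have -> : `|(p%:Z - k%:Z + K%:Z)%R| = p + K - k.
    by rewrite /K; move: p k {pk K}; clear; lia.
  have kpK : k <= p + K by rewrite /K; move: p k {pk K}; clear; lia.
  have pK : p + K - k < size (W K).
    by move: pk; rewrite !sW /K; move: (size w) p k {kpK K}; clear; lia.
  have [kK|Kk] := leqP k K.
    by rewrite -(WD k (K - k)) // subnKC // addnBA.
  have e : p = p + K - k + (k - K) by move: kpK Kk; clear; lia.
  by have := WD K (k - K) _ pK; rewrite -e subnKC ?(ltnW Kk).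
have xW k : W k = mkseq (fun j => x (- k%:Z + j%:Z)%R) (size (W k)).
  apply: (@eq_from_nth _ d) => [|j jk]; first by rewrite size_mkseq.
  by rewrite nth_mkseq // addrC xE.
exists x; last by exists 0%R; rewrite [LHS](xW 0) oppr0.
move=> u Fu [i ux].
have : infix u (W (`|i| + size u)).
  rewrite [W _]xW; set k := _ + _.
  have [c ci] : exists c : nat, (i = - k%:Z + c%:Z)%R.
    by exists `|(i + k%:Z)%R|; rewrite /k; move: (size u); clear; lia.
  have cW : c + size u <= size (W k).
    by rewrite sW; move: ci; rewrite /k; move: (size u) (size w); clear; lia.
  apply/infixP.
  set s := mkseq _ _; exists (take c s), (drop (c + size u) s).
  have -> : u = take (size u) (drop c s).
    rewrite {1}ux; apply: (@eq_from_nth _ d).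
      by rewrite size_mkseq size_takel // size_drop size_mkseq leq_subRL //; lia.
    rewrite size_mkseq => j ju; rewrite nth_mkseq // nth_take // nth_drop.
    by rewrite nth_mkseq ?ci ?PoszD ?addrA //; lia.
  rewrite size_takel; last by rewrite size_drop size_mkseq leq_subRL //; lia.
  by rewrite addnC -drop_drop !cat_take_drop.
apply/negP; have [p [q [_ _ Fpq]]] := extW (`|i| + size u) 0.
by apply: (factorial_avoids _ Fpq) => //; exact: infix_infix.
Qed.

End Words.

(** * Submultiplicative sequences and records *)

Section Sequences.
Variable R : realType.
Implicit Types (u r : nat -> R).

(** Divide n by m; the constant C absorbs the finitely many remainders. *)
Lemma submultiplicative_growth u (theta : R) m :
  (forall n, 0 <= u n) -> (forall i j, u (i + j)%N <= u i * u j) ->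
  (0 < m)%N -> u m <= expR (m%:R * theta) ->
  exists2 C, 0 < C & forall n, u n <= C * expR (n%:R * theta).
Proof.
move=> u0 uM m0 um.
pose C := 1 + \sum_(j < m) u j * expR (- (j%:R * theta)).
have C0 : 0 < C.
  by rewrite /C ltr_pwDl // sumr_ge0 // => j _; rewrite mulr_ge0 ?expR_ge0.
have small j : (j < m)%N -> u j <= C * expR (j%:R * theta).
  move=> jm; rewrite -ler_pdivrMr ?expR_gt0 // -expRN /C.
  rewrite (bigD1 (Ordinal jm)) //= addrCA lerDl addr_ge0 // sumr_ge0 // => i _.
  by rewrite mulr_ge0 ?expR_ge0.
clearbody C; exists C => // n; rewrite (divn_eq n m); elim: (n %/ m)%N => [|q IH].
  by rewrite mul0n add0n; apply: small; rewrite ltn_mod.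
rewrite mulSn -addnA; apply: (le_trans (uM _ _)).
rewrite natrD mulrDl expRD mulrCA.
by apply: ler_pM.
Qed.

(** Fekete's lemma in multiplicative form. The infimum is a lower bound for every
term, and [submultiplicative_growth], applied at an index m where the
infimum is nearly attained, bounds the sequence from above. *)
Lemma submultiplicative_cvg u :
  (forall n, 1 <= u n) -> (forall i j, u (i + j)%N <= u i * u j) ->
  (fun n => ln (u n) / n%:R) @ \oo -->
    inf [set ln (u n) / n%:R | n in [set n | (0 < n)%N]].
Proof.
move=> u1 uM; set S := [set _ | _ in _].
have u0 n : 0 <= u n by apply: le_trans (u1 n).
have u0' n : 0 < u n by apply: lt_le_trans (u1 n).
have lbS : has_lbound S.
  by exists 0 => _ [n _ <-]; rewrite divr_ge0 ?ler0n ?ln_ge0.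
have hS : has_inf S by split=> //; exists (ln (u 1%N) / 1%:R), 1%N.
apply/cvgrPdist_le => e e0.
have e2 : 0 < e / 2 by rewrite divr_gt0.
have [_ [m /= m0 <-] um] := inf_adherent e2 hS.
have m0R : 0 < m%:R :> R by rewrite ltr0n.
have [C C0 uC] : exists2 C, 0 < C &
    forall n, u n <= C * expR (n%:R * (inf S + e / 2)).
  apply: (submultiplicative_growth u0 uM m0).
  rewrite -[u m]lnK ?posrE // ler_expR mulrC -ler_pdivrMr //; exact: ltW.
near=> n.
have n0 : (0 < n)%N by near: n; exists 1%N.
have n0R : 0 < n%:R :> R by rewrite ltr0n.
have lo : inf S <= ln (u n) / n%:R by apply: ge_inf => //; exists n.
rewrite distrC ger0_norm ?subr_ge0 // lerBlDl.
rewrite ler_pdivrMr //.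
have : ln (u n) <= ln C + n%:R * (inf S + e / 2).
  by rewrite -[X in _ + X]expRK -lnM ?posrE ?expR_gt0 // ler_ln ?posrE // mulr_gt0 ?expR_gt0.
have : ln C <= n%:R * (e / 2).
  rewrite -ler_pdivrMr //; near: n; exact: nbhs_infty_ger.
move=> h1 h2; rewrite (le_trans h2) //; move: h1; set x := inf S; set y := n%:R.
nra.
Unshelve. all: by end_near.
Qed.

(** If y = c r n > 1, then replacing an index by a record below it and doubling
squares c r at each step: some index j <= 2^k n has c r j >= y^(2^k). With
the rate e = ln y / (2n), subexponential growth allows at most a constant
times y^(2^k / 2), which is too small for large k. *)
Lemma record_growth r (c : R) : 0 < c -> c <= 1 -> r 0%N = 1 ->
  (forall n, 0 <= r n) ->
  (forall m, (forall j, (j <= m)%N -> r j <= r m) -> c * r m ^+ 2 <= r (m + m)%N) ->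
  (forall e, 0 < e -> exists2 C, 0 < C & forall n, r n <= C * expR (n%:R * e)) ->
  forall n, c * r n <= 1.
Proof.
move=> c0 c1 r01 r0 rec sub n; rewrite leNgt; apply/negP => y1.
set y := c * r n in y1.
have n0 : (0 < n)%N.
  by rewrite lt0n; apply/negP => /eqP nE; move: y1; rewrite /y nE r01 mulr1 ltNge c1.
have double k : exists2 j, (j <= 2 ^ k * n)%N & y ^+ (2 ^ k) <= c * r j.
  elim: k => [|k [j jn yj]]; first by exists n; rewrite ?mul1n ?expr1.
  (* i is a record index at most j, with r i at least r j *)
  have [i _ imax] := @arg_maxP _ _ _ (@ord0 j) xpredT (fun i : 'I_j.+1 => r i) isT.
  have im l : (l <= j)%N -> r l <= r i.
    by move=> lj; have := imax (Ordinal (lj : (l < j.+1)%N)) isT.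
  have ij : (i <= j)%N by rewrite -ltnS.
  exists (i + i)%N.
    by rewrite expnS -mulnA mul2n -addnn leq_add // (leq_trans ij).
  rewrite expnSr exprM expr2.
  have h : y ^+ (2 ^ k) <= c * r i.
    by rewrite (le_trans yj) // ler_pM2l // im.
  apply: (@le_trans _ _ ((c * r i) * (c * r i))).
    by rewrite ler_pM // exprn_ge0 // ltW // (lt_trans _ y1).
  rewrite -mulrA ler_pM2l // mulrCA -expr2; apply: rec => l li.
  by apply: im; exact: leq_trans ij.
have y0 : 0 < y by exact: lt_trans y1.
have lny : 0 < ln y by rewrite ln_gt0.
have n0R : 0 < n%:R :> R by rewrite ltr0n.
have [|C C0 rC] := sub (ln y / (2 * n%:R)); first by rewrite divr_gt0 // mulr_gt0.
have bound k : (2 ^ k)%:R * (ln y / 2) <= ln (c * C).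
  have [j jn yj] := double k.
  have cC : 0 < c * C by rewrite mulr_gt0.
  have : y ^+ (2 ^ k) <= c * C * expR ((2 ^ k)%:R * (ln y / 2)).
    apply: (le_trans yj); rewrite -mulrA ler_pM2l // (le_trans (rC j)) //.
    rewrite ler_pM2l // ler_expR.
    have -> : (2 ^ k)%:R * (ln y / 2) = (2 ^ k * n)%:R * (ln y / (2 * n%:R)).
      by rewrite natrM; field; rewrite gt_eqF.
    by rewrite ler_pM2r ?ler_nat // divr_gt0 // mulr_gt0.
  rewrite -{1}[y]lnK ?posrE // -expRM_natl -ler_pdivrMr ?expR_gt0 // -expRN -expRD.
  rewrite -[c * C]lnK ?posrE // ler_expR.
  by rewrite expRK; move: (ln (c * C)) (2 ^ k)%:R => z t; lra.
pose k := Num.truncn (ln (c * C) / (ln y / 2)).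
have := bound k.+1; rewrite -ler_pdivlMr ?divr_gt0 // => hk.
have : ln (c * C) / (ln y / 2) < k.+1%:R by exact: truncnS_gt.
by rewrite ltNge (le_trans _ hk) // ler_nat ltnW // ltn_expl.
Qed.
End Sequences.

(** * Entropy and the growth of avoiding words *)

Section Entropy.
Variables (R : realType) (A : finType) (F : set (seq A)).
Hypothesis X0 : subshift F !=set0.
Let X := subshift F.
Let L := language X.

Lemma appears_infix (x : int -> A) (u w : seq A) :
  infix u w -> appears w x -> appears u x.
Proof.
move=> /infixP[p [q ->]] [i e]; exists (i + (size p)%:Z).
have [->//|[d _]] : u = [::] \/ exists d : A, True.
  by case: (u) => [|d ?]; [left|right; exists d].
apply: (@eq_from_nth _ d) => [|j ju]; first by rewrite size_mkseq.
have := congr1 (fun s => nth d s (size p + j)) e.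
rewrite nth_cat ltnNge leq_addr /= addKn nth_cat ju => ->.
rewrite !nth_mkseq ?PoszD ?addrA // !size_cat ltn_add2l.
exact: (leq_trans ju (leq_addr _ _)).
Qed.

Lemma factorial_subshift : factorial_language L.
Proof.
by move=> w u uw [x Xx wx]; exists x => //; exact: appears_infix wx.
Qed.

Lemma language_avoids w : L w -> avoids F w.
Proof.
move=> [x Xx wx] u Fu; apply/negP => uw.
by apply: (Xx u Fu); exact: appears_infix wx.
Qed.

Lemma nwords_language_gt0 n : (0 < nwords L n)%N.
Proof.
have [x Xx] := X0; rewrite -size_words.
have : mkseq (fun k : nat => x (0 + k%:Z)) n \in words L n.
  apply/wordsP; rewrite size_mkseq; split=> //; exists x => //.
  by exists 0; rewrite size_mkseq.
by case: (words L n).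
Qed.

Lemma entropyE : entropy R X =
  inf [set ln ((nwords L n)%:R : R) / n%:R | n in [set n | (0 < n)%N]].
Proof.
apply/cvg_lim; first exact: Rhausdorff.
apply: (@submultiplicative_cvg R (fun n => (nwords L n)%:R)) => [n|i j].
  by rewrite ler1n nwords_language_gt0.
by rewrite -natrM ler_nat; apply: nwordsD; exact: factorial_subshift.
Qed.

Let lbL : has_lbound
  [set ln ((nwords L n)%:R : R) / n%:R | n in [set n | (0 < n)%N]].
Proof.
by exists 0 => _ [n _ <-]; rewrite divr_ge0 ?ler0n ?ln_ge0 ?ler1n ?nwords_language_gt0.
Qed.

(** The entropy is an infimum, so its term n = 1 bounds it. *)
Lemma entropy_le_card : entropy R X <= ln #|A|%:R.
Proof.
rewrite entropyE; apply: (@le_trans _ _ (ln ((nwords L 1)%:R : R) / 1%:R)).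
  by apply: ge_inf => //; exists 1%N.
have L1 := nwords_language_gt0 1.
have LA : (nwords L 1 <= #|A|)%N by rewrite -[#|A|]expn1; exact: nwords_le_expn.
by rewrite divr1 ler_ln ?posrE ?ltr0n ?ler_nat // (leq_trans L1).
Qed.

(** Choose m with |L_m| <= e^(m (h + e)), and N so large that every word of
length m extendable by N on both sides lies in the language. Then the words
extendable by N form a factorial language with growth rate at most h + e, and an
avoiding word is one of these up to its two ends of length N. *)
Lemma nwords_avoids_growth (e : R) : 0 < e -> exists2 C, 0 < C &
  forall n, (nwords (avoids F) n)%:R <= C * expR (n%:R * (entropy R X + e)).
Proof.
move=> e0.
have [_ [m /= m0 <-]] : exists2 x, [set ln ((nwords L n)%:R : R) / n%:R |
    n in [set n | (0 < n)%N]] x & x < entropy R X + e.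
  rewrite entropyE; apply: inf_adherent => //; split=> //.
  by exists (ln ((nwords L 1)%:R : R) / 1%:R), 1%N.
set th := entropy R X + e => hm.
have m0R : 0 < m%:R :> R by rewrite ltr0n.
have [N NP] := @antitone_stable _ (fun (t : m.-tuple A) N => extendable F N t)
  (fun t i j => @extendable_antitone _ F t i j).
have [C C0 CP] : exists2 C, 0 < C &
    forall n, (nwords (extendable F N) n)%:R <= C * expR (n%:R * th).
  apply: (@submultiplicative_growth _ _ _ m) => // [i j|].
    by rewrite -natrM ler_nat; apply: nwordsD; exact: factorial_extendable.
  apply: (@le_trans _ _ (nwords L m)%:R).
    rewrite ler_nat; apply: nwords_le => w sw ew.
    have sw' : size w == m by apply/eqP.
    exact/language_extendable/(NP (Tuple sw')).
  rewrite -[X in X <= _]lnK ?posrE ?ltr0n ?nwords_language_gt0 // ler_expR.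
  by rewrite mulrC -ler_pdivrMr // ltW.
have A0 : 0 < #|A|%:R :> R.
  by have [x _] := X0; rewrite ltr0n; apply/card_gt0P; exists (x 0).
pose K : R := (#|A| ^ N)%:R * (#|A| ^ N)%:R.
have K0 : 0 < K by rewrite /K !natrX mulr_gt0 ?exprn_gt0.
(* nonnegativity of the rate lets e^((n - 2N) th) be replaced by e^(n th) *)
have h0 : 0 <= entropy R X.
  rewrite entropyE; apply: lb_le_inf.
    by exists (ln ((nwords L 1)%:R : R) / 1%:R), 1%N.
  by move=> _ [n _ <-]; rewrite divr_ge0 ?ler0n ?ln_ge0 ?ler1n ?nwords_language_gt0.
have th0 : 0 <= th by rewrite addr_ge0 // ltW.
(* the summand 1 covers the words too short to have a middle part *)
exists (K * (C + 1)) => [|n]; first by rewrite mulr_gt0 // addr_gt0.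
have A1 : 1 <= #|A|%:R :> R by rewrite ler1n -(ltr0n R).
have [nN|Nn] := leqP (N + N) n.
  have -> : n = (N + (n - (N + N)) + N)%N by rewrite addnAC subnKC.
  set k := (n - _)%N.
  apply: (@le_trans _ _ (K * (nwords (extendable F N) k)%:R)).
    by rewrite /K mulrAC -!natrM ler_nat nwords_avoids_extendable.
  rewrite -(mulrA K) ler_pM2l // (le_trans (CP k)) //.
  rewrite ler_pM ?expR_ge0 ?(ltW C0) ?lerDl // ler_expR ler_wpM2r // ler_nat.
  by rewrite addnAC leq_addl.
apply: (@le_trans _ _ (#|A| ^ n)%:R); first by rewrite ler_nat nwords_le_expn.
apply: (@le_trans _ _ K).
  by rewrite /K !natrX -exprD ler_weXn2l // ltnW.
rewrite -(mulrA K) ler_peMr ?(ltW K0) //.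
rewrite -[X in X <= _]mulr1 ler_pM //; first by rewrite lerDr ltW.
by rewrite -expR0 ler_expR mulr_ge0.
Qed.
End Entropy.

(** * Few concatenations are spoiled *)

Section Records.
Variables (R : realType) (A : finType) (F : set (seq A)).

(** At a record m, cutting a forbidden word of length k out of a concatenation
leaves words of lengths m - i and m - (k - i), and the record property
pays e^(-ih) and e^(-(k - i)h) for their shortness, whatever the cut i; the
k possible cuts produce the factor k. *)
Lemma nwords_avoids_record (h : R) (delta : R) m (a := nwords (avoids F)) :
  (forall K, \sum_(1 <= k < K) k%:R * (nwords F k)%:R * expR (- (k%:R * h))
     <= delta) ->
  (forall j, (j <= m)%N -> (a j)%:R * expR (- (j%:R * h)) <=
                           (a m)%:R * expR (- (m%:R * h))) ->
  (1 - delta) * (a m)%:R ^+ 2 <= (a (m + m)%N)%:R.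
Proof.
move=> sumF rec.
have am j : (j <= m)%N -> (a (m - j)%N)%:R <= (a m)%:R * expR (- (j%:R * h)).
  move=> jm; have := rec _ (leq_subr j m).
  rewrite -ler_pdivlMr ?expR_gt0 // -expRN opprK -mulrA -expRD natrB //.
  by rewrite mulrBl addrA addNr add0r.
have := nwords_avoids_mul F m m; rewrite /= -/a -(ler_nat R) natrD natrM -expr2.
rewrite mulrBl mul1r lerBlDr => /le_trans; apply; rewrite lerD2l.
rewrite [X in _ <= X]mulrC.
apply: (le_trans _ (ler_wpM2l (exprn_ge0 2 (ler0n R (a m))) (sumF (m + m).+1))).
rewrite mulr_sumr natr_sum; apply: ler_sum_nat => k /andP[k0 _].
rewrite natr_sum.
pose T : R := (nwords F k)%:R * ((a m)%:R ^+ 2 * expR (- (k%:R * h))).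
apply: (@le_trans _ _ (\sum_(0 <= i < k) T)).
  rewrite big_mkcond; apply: ler_sum_nat => i /andP[_ ik].
  case: ifP => [/andP[im kim]|_]; last by rewrite !mulr_ge0 ?expR_ge0.
  rewrite natrM ler_wpM2l // natrM.
  have -> : expR (- (k%:R * h)) = expR (- (i%:R * h)) * expR (- ((k - i)%:R * h)).
    by rewrite -expRD -opprD -mulrDl -natrD subnKC // ltnW.
  by rewrite expr2 mulrACA ler_pM // am.
rewrite sumr_const_nat subn0 -mulr_natl /T le_eqVlt; apply/orP; left.
by apply/eqP; ring.
Qed.

End Records.

Theorem theorem4p3 (R : realType) (A : finType) (F : set (seq A))
    (F_nonempty_words : forall w, F w -> w <> [::])
    (X_nonempty : subshift F !=set0)
    (small_sum : exists beta : R,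
        beta < 2 * entropy R (subshift F) - ln (#|A|%:R : R) /\
        (\sum_(1 <= n <oo)
           (n%:R * #|words_of_length F n|%:R * expR (- (n%:R * beta)))%:E
         < (36%:R^-1 : R)%:E)%E) :
  \forall n \near \oo,
    (#|words_of_length (language (subshift F)) n|%:R : R)
      < 4 * expR (n%:R * entropy R (subshift F)).
Proof.
set h := entropy R (subshift F).
have [beta [hbeta sbeta]] := small_sum.
(* since h <= ln #|A|, the bound 2 h - ln #|A| on beta is at most h *)
have bh : beta <= h.
  by move: hbeta (entropy_le_card R X_nonempty); rewrite -/h; move: (ln _) => l; lra.
have sumF K : \sum_(1 <= k < K) k%:R * (nwords F k)%:R * expR (- (k%:R * h))
    <= 36%:R^-1.
  apply: (@le_trans _ _ (\sum_(1 <= k < K)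
      k%:R * (nwords F k)%:R * expR (- (k%:R * beta)))).
    apply: ler_sum_nat => k _; rewrite ler_wpM2l ?mulr_ge0 // ler_expR lerN2.
    by rewrite ler_wpM2l.
  rewrite -lee_fin -sumEFin; apply: le_trans (ltW sbeta).
  by apply: nneseries_lim_ge => k _ _; rewrite lee_fin !mulr_ge0 ?expR_ge0.
pose a n : R := (nwords (avoids F) n)%:R.
have a0 : nwords (avoids F) 0 = 1%N.
  apply/eqP; rewrite eqn_leq; apply/andP; split.
    by rewrite (leq_trans (nwords_le_expn _ _)).
  rewrite (leq_trans (nwords_language_gt0 X_nonempty 0)) //.
  by apply: nwords_le => w _; exact: language_avoids.
have bound n : (1 - 36%:R^-1) * (a n * expR (- (n%:R * h))) <= 1.
  move: n; apply: (@record_growth R (fun n => a n * expR (- (n%:R * h))));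
    rewrite ?subr_gt0 ?lerBlDr.
  - lra.
  - lra.
  - by rewrite /a a0 mul0r oppr0 expR0 mulr1.
  - by move=> n; rewrite mulr_ge0 ?expR_ge0 ?ler0n.
  - move=> m rec; have h2 := nwords_avoids_record sumF rec.
    have -> : expR (- ((m + m)%:R * h)) = expR (- (m%:R * h)) ^+ 2.
      by rewrite natrD mulrDl opprD expRD expr2.
    by rewrite exprMn [leLHS]mulrA ler_pM2r ?exprn_gt0 ?expR_gt0.
  - move=> e e0; have [C C0 CP] := nwords_avoids_growth X_nonempty e0.
    exists C => // n; rewrite -ler_pdivlMr ?expR_gt0 // -expRN opprK -mulrA -expRD.
    by rewrite -mulrDr (addrC e); exact: CP.
near=> n.
apply: (@le_lt_trans _ _ (a n)).
  by rewrite ler_nat; apply: nwords_le => w _; exact: language_avoids.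
rewrite -ltr_pdivrMr ?expR_gt0 // -expRN.
by move: (bound n); move: (a n * _) => t; lra.
Unshelve. all: by end_near.
Qed.
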